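(* Let $G=G_1\ast_A G_2$ be an amalgam of finite groups. The separability problem for $G$ is solvable if one of the following holds: (1) $A$ is cyclic; (2) $A$ is malnormal in at least one of the factors $G_1$ or $G_2$; (3) $A\le Z(G_i)$ for some $i\in\{1,2\}$. In particular, the separability problem for $G$ is solvable if at least one of the factors $G_1$ or $G_2$ is Abelian.
   Context: Setting: $G=G_1\ast_A G_2$ is a free product with amalgamation of finite groups $G_1=\langle X_1\mid R_1\rangle$ and $G_2=\langle X_2\mid R_2\rangle$, given by finite presentations with $X_1^{\pm}\cap X_2^{\pm}=\emptyset$, along a group $A=\langle Y\rangle$ with monomorphisms $\phi_i:A\to G_i$ ($i=1,2$), so $G=\langle X_1\cup X_2\mid R_1,R_2,\phi_1(a)=\phi_2(a)\ (a\in Y)\rangle$. We identify $A$ with its images in $G_1$ and $G_2$, and $G_1,G_2$ with their images in $G$. All this data (including the Cayley graphs and relative Cayley graphs of $G_1,G_2$) is given; elements of $G$ are represented by words over $(X_1\cup X_2)^{\pm}$. Separability problem for $G$: find an algorithm which, given a finitely generated subgroup $H\le G$ (by a finite set of generators) and an element $g\in G$ with $g\notin H$, constructs a separating subgroup $K$, that is, a subgroup $K\le G$ of finite index with $H\le K$ and $g\notin K$. The problem is solvable for $G$ if such an algorithm exists. A subgroup $A\le G_i$ is malnormal in $G_i$ if $g^{-1}Ag\cap A=\{1\}$ for all $g\in G_i\setminus A$. $Z(G_i)$ is the center of $G_i$. *)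

(* Defs.v *)
From HB Require Import structures.
From mathcomp Require Import all_boot all_fingroup all_solvable.

Set Implicit Arguments.
Unset Strict Implicit.
Unset Printing Implicit Defensive.

Local Open Scope group_scope.

(* The letter (x, b) stands for x if b = false, and for x^-1 if b = true. *)
Definition word (X : Type) : Type := seq (X * bool).

Definition inv_word (X : Type) (w : word X) : word X :=
  [seq (l.1, ~~ l.2) | l <- rev w].

Definition map_word (X Y : Type) (f : X -> Y) (w : word X) : word Y :=
  [seq (f l.1, l.2) | l <- w].

Definition weval (X : Type) (G : groupType) (e : X -> G) (w : word X) : G :=
  \prod_(l <- w) (if l.2 then (e l.1)^-1 else e l.1).

(* Equality in < X | R >: the equivalence generated by inserting or deleting
   x x^-1, x^-1 x or a relator anywhere in a word. *)
Inductive word_equiv (X : eqType) (R : seq (word X)) :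
    word X -> word X -> Prop :=
| we_refl u : word_equiv R u u
| we_sym u v : word_equiv R u v -> word_equiv R v u
| we_trans u v w : word_equiv R u v -> word_equiv R v w -> word_equiv R u w
| we_cancel u v x b :
    word_equiv R (u ++ (x, b) :: (x, ~~ b) :: v) (u ++ v)
| we_relator u v r : r \in R -> word_equiv R (u ++ r ++ v) (u ++ v).

(* G = < X | R > via e: the map from the free group on X to G extending e is
   onto, and its kernel is the normal closure of R. *)
Definition presents (X : eqType) (R : seq (word X)) (G : groupType)
    (e : X -> G) : Prop :=
  (forall g : G, exists w : word X, weval e w = g) /\
  (forall w : word X, weval e w = 1 <-> word_equiv R w [::]).

(* The relators R1, R2 and phi1(a) phi2(a)^-1 for a in Y, where u1 a and u2 a
   are words representing phi1(a) and phi2(a).  The disjointness of the two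
   alphabets is built into the sum type. *)
Definition amalgam_relators (X1 X2 : Type) (R1 : seq (word X1))
    (R2 : seq (word X2)) (A : Type) (Y : seq A)
    (u1 : A -> word X1) (u2 : A -> word X2) : seq (word (X1 + X2)) :=
  [seq map_word inl r | r <- R1] ++ [seq map_word inr r | r <- R2] ++
  [seq map_word inl (u1 a) ++ inv_word (map_word inr (u2 a)) | a <- Y].

Definition malnormal (gT : finGroupType) (B G : {set gT}) : Prop :=
  forall g, g \in G :\: B -> (B :^ g) :&: B = 1.

(* groupType may be infinite, so subgroups are Prop-valued predicates. *)
Definition is_subgroup (G : groupType) (K : G -> Prop) : Prop :=
  [/\ K 1, forall x y, K x -> K y -> K (x * y) & forall x, K x -> K x^-1].

Definition generated (G : groupType) (S : seq G) (x : G) : Prop :=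
  forall K : G -> Prop,
    is_subgroup K -> (forall s, s \in S -> K s) -> K x.

Definition finite_index (G : groupType) (K : G -> Prop) : Prop :=
  exists ts : seq G, forall x : G, exists2 t, t \in ts & K (t^-1 * x).

Definition separating (G : groupType) (H : G -> Prop) (g : G)
    (K : G -> Prop) : Prop :=
  [/\ is_subgroup K, finite_index K, (forall x, H x -> K x) & ~ K g].

(* Kleene's partial recursive functions.  Arities are not tracked: a missing
   argument is read as 0. *)
Inductive recfn : Type :=
| RZero
| RSucc
| RProj of nat
| RComp of recfn & seq recfn
| RPrim of recfn & recfn
| RMu of recfn.

(* computes f s y: f is defined on the arguments s, with value y. *)
Inductive computes : recfn -> seq nat -> nat -> Prop :=
| c_zero s : computes RZero s 0
| c_succ s : computes RSucc s (nth 0 s 0).+1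
| c_proj i s : computes (RProj i) s (nth 0 s i)
| c_comp f gs s ys y :
    computes_all gs s ys -> computes f ys y -> computes (RComp f gs) s y
| c_prim0 f g s y : computes f s y -> computes (RPrim f g) (0 :: s) y
| c_primS f g n s z y :
    computes (RPrim f g) (n :: s) z -> computes g [:: n, z & s] y ->
    computes (RPrim f g) (n.+1 :: s) y
| c_mu f s n :
    computes f (n :: s) 0 ->
    (forall m, m < n -> exists k, computes f (m :: s) k.+1) ->
    computes (RMu f) s n
with computes_all : seq recfn -> seq nat -> seq nat -> Prop :=
| ca_nil s : computes_all [::] s [::]
| ca_cons g gs s y ys :
    computes g s y -> computes_all gs s ys ->
    computes_all (g :: gs) s (y :: ys).

Definition letter_code (X : finType) (l : X * bool) : nat :=
  (enum_rank l.1).*2 + l.2.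

Definition word_code (X : finType) (w : word X) : nat :=
  CodeSeq.code [seq letter_code l | l <- w].

Definition words_code (X : finType) (ws : seq (word X)) : nat :=
  CodeSeq.code [seq word_code w | w <- ws].

(* An algorithm takes words hs generating H and a word g, and if g is not in H
   it returns words generating a separating subgroup. *)
Definition separability_solvable (X : finType) (G : groupType) (e : X -> G) :
    Prop :=
  exists p : recfn, forall (hs : seq (word X)) (g : word X),
    let H := generated [seq weval e h | h <- hs] in
    ~ H (weval e g) ->
    exists ks : seq (word X),
      computes p [:: words_code (g :: hs)] (words_code ks) /\
      separating H (weval e g) (generated [seq weval e k | k <- ks]).

(* Main.v *)
(* Amalgams G of finite groups are subgroup separable.  Given H and g not in H,
   a finite set S of right cosets of H contains all those met when reading g and
   the generators of H from the base coset.  G1 acts on the finite set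
   U = S G1 u S G2, by right multiplication on S G1 and trivially elsewhere, and
   G2 acts similarly.  The two restrictions to A may differ, but they become
   conjugate on U * G1 * G2, by a permutation preserving the fibres over S: on
   U * A, conjugate by (u, a) |-> (u . a^-1 . a, a), with a^-1 acting through G1
   and a through G2.  So G acts on the finite set U * G1 * G2, and the fibre over
   the base coset is stabilised by H but not by g.
   Hence an unbounded search finds a finite coset table, and the Schreier
   generators of the stabiliser of its base point are the answer. *)

From mathcomp Require Import all_boot all_fingroup all_solvable boolp.
Require Import Defs.

Set Implicit Arguments.
Unset Strict Implicit.
Unset Printing Implicit Defensive.

(** * Total recursive functions *)

Definition computable (k : nat) (f : seq nat -> nat) : Prop :=
  exists p, forall s, size s = k -> computes p s (f s).

Lemma eq_computable k f g : f =1 g -> computable k f -> computable k g.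
Proof. by move=> efg [p Hp]; exists p => s /Hp; rewrite efg. Qed.

Lemma computable_nth k i : computable k (fun s => nth 0 s i).
Proof. by exists (RProj i) => s _; apply: c_proj. Qed.

(** Each recursion pushes a counter and an accumulator in front of the parameters, so variables
    occur under nested [behead]s. *)
Lemma computable_nth_behead k d i :
  computable k (fun s => nth 0 (iter d behead s) i).
Proof.
apply: eq_computable (computable_nth k (d + i)) => s.
elim: d s => [|d IHd] s; first by [].
by rewrite iterSr -IHd addSn nth_behead.
Qed.

Lemma computable_succ k a : computable k a -> computable k (fun s => (a s).+1).
Proof.
move=> [p Hp]; exists (RComp RSucc [:: p]) => s sz.
by apply: (c_comp (ys := [:: a s])); [do 2?constructor; apply: Hp | exact: c_succ].
Qed.

Lemma computable_const k n : computable k (fun=> n).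
Proof.
elim: n => [|n]; last exact: computable_succ.
by exists RZero => s _; apply: c_zero.
Qed.

Lemma computable_comp1 k f a : computable 1 f -> computable k a ->
  computable k (fun s => f [:: a s]).
Proof.
move=> [p Hp] [q Hq]; exists (RComp p [:: q]) => s sz.
apply: (c_comp (ys := [:: a s])); last exact: Hp.
by do 2?constructor; apply: Hq.
Qed.

(** Projections hand the argument list on to a composed function, whole or without its first [d]
    entries. *)
Lemma computes_proj d s :
  computes_all [seq RProj i | i <- iota d (size s - d)] s (drop d s).
Proof.
move E: (size s - d) => n; elim: n d E => [|n IHn] d E.
  by rewrite drop_oversize -?subn_eq0 ?E //; constructor.
have lt_d : d < size s by rewrite -subn_gt0 E.
rewrite (drop_nth 0 lt_d) /=; constructor; first exact: c_proj.
by apply: IHn; rewrite subnS E.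
Qed.

Lemma computable_rec k a f (g : nat -> nat -> seq nat -> nat) :
    computable k a -> computable k f ->
    computable k.+2 (fun s => g (nth 0 s 0) (nth 0 s 1) (behead (behead s))) ->
  computable k (fun s => nat_rect (fun=> nat) (f s) (fun n z => g n z s) (a s)).
Proof.
move=> [p Hp] [q Hq] [r Hr].
exists (RComp (RPrim q r) (p :: [seq RProj i | i <- iota 0 k])) => s sz.
apply: (c_comp (ys := a s :: s)).
  constructor; first exact: Hp.
  by have := computes_proj 0 s; rewrite subn0 drop0 sz.
elim: (a s) => [|n IHn] /=; first by constructor; apply: Hq.
by apply: c_primS IHn _; apply: (Hr [:: n, _ & s]); rewrite /= sz.
Qed.

(** Minimisation stops at the least root [c'] of [chk], which may differ from [c]. As [chk] is
    total, its values below [c'] are defined and positive, as [c_mu] demands. *)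
Lemma computable_search (chk : nat -> nat -> nat) (out : nat -> nat) :
    computable 2 (fun s => chk (nth 0 s 0) (nth 0 s 1)) ->
    computable 1 (fun s => out (nth 0 s 0)) ->
  exists p, forall x c, chk c x = 0 ->
    exists2 c', chk c' x = 0 & computes p [:: x] (out c').
Proof.
move=> [p Hp] [q Hq]; exists (RComp q [:: RMu p]) => x c chk0.
have ex0 : exists c, chk c x == 0 by exists c; apply/eqP.
case: (ex_minnP ex0) => c' /eqP chk' min'; exists c' => //.
apply: (c_comp (ys := [:: c'])); last exact: (Hq [:: c']).
do 2?constructor; first by rewrite -chk'; apply: (Hp [:: c'; x]).
move=> m lt_m; exists (chk m x).-1; rewrite prednK; first exact: (Hp [:: m; x]).
by rewrite lt0n; apply/negP => /min'; rewrite leqNgt lt_m.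
Qed.

Create HintDb recursive.

Ltac computable_var :=
  solve [ exact: computable_nth | exact: (computable_nth_behead _ 1)
        | exact: (computable_nth_behead _ 2) | exact: (computable_nth_behead _ 3)
        | exact: (computable_nth_behead _ 4) | exact: (computable_nth_behead _ 5)
        | exact: (computable_nth_behead _ 6) | exact: computable_const ].

Hint Extern 0 (computable _ _) => computable_var : recursive.
Hint Resolve computable_succ : recursive.

Ltac computability := eauto 40 with recursive nocore.

Lemma computable_iter k a f (g : nat -> seq nat -> nat) :
    computable k a -> computable k f ->
    computable k.+2 (fun s => g (nth 0 s 1) (behead (behead s))) ->
  computable k (fun s => iter (a s) (fun z => g z s) (f s)).
Proof.
move=> Ha Hf Hg; apply: eq_computable (computable_rec (g := fun _ => g) Ha Hf Hg).
by move=> s; elim: (a s) => //= n ->.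
Qed.

Lemma computable_pred k a : computable k a -> computable k (fun s => (a s).-1).
Proof.
move=> Ha.
apply: eq_computable (computable_rec (g := fun n _ _ => n) Ha (computable_const k 0) _).
  by move=> s; case: (a s).
by computability.
Qed.
Hint Resolve computable_pred : recursive.

Lemma computable_add k a b : computable k a -> computable k b ->
  computable k (fun s => a s + b s).
Proof.
move=> Ha Hb; apply: eq_computable (computable_iter (g := fun z _ => z.+1) Ha Hb _).
  by move=> s; elim: (a s) => //= n ->.
by computability.
Qed.
Hint Resolve computable_add : recursive.

Lemma computable_sub k a b : computable k a -> computable k b ->
  computable k (fun s => a s - b s).
Proof.
move=> Ha Hb; apply: eq_computable (computable_iter (g := fun z _ => z.-1) Hb Ha _).
  by move=> s; elim: (b s) => /= [|n ->]; rewrite ?subn0 ?subnS.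
by computability.
Qed.
Hint Resolve computable_sub : recursive.

Lemma computable_comp2 k (F : nat -> nat -> nat) a b :
    computable 2 (fun s => F (nth 0 s 0) (nth 0 s 1)) ->
    computable k a -> computable k b ->
  computable k (fun s => F (a s) (b s)).
Proof.
move=> [p Hp] [q Hq] [r Hr]; exists (RComp p [:: q; r]) => s sz.
apply: (c_comp (ys := [:: a s; b s])); last exact: (Hp [:: a s; b s]).
by do 3?constructor; [apply: Hq | apply: Hr].
Qed.

Lemma computable_comp3 k (F : nat -> nat -> nat -> nat) a b c :
    computable 3 (fun s => F (nth 0 s 0) (nth 0 s 1) (nth 0 s 2)) ->
    computable k a -> computable k b -> computable k c ->
  computable k (fun s => F (a s) (b s) (c s)).
Proof.
move=> [p Hp] [q Hq] [r Hr] [t Ht]; exists (RComp p [:: q; r; t]) => s sz.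
apply: (c_comp (ys := [:: a s; b s; c s])); last exact: (Hp [:: a s; b s; c s]).
by do 4?constructor; [apply: Hq | apply: Hr | apply: Ht].
Qed.

Lemma computable_mul k a b : computable k a -> computable k b ->
  computable k (fun s => a s * b s).
Proof.
apply: computable_comp2 => {k a b}.
have H : computable 2 (fun s => iter (nth 0 s 0) (fun z => nth 0 s 1 + z) 0).
  by apply: (computable_iter (g := fun z s => nth 0 s 1 + z)); computability.
by apply: eq_computable H => s; rewrite iter_addn_0 mulnC.
Qed.
Hint Resolve computable_mul : recursive.

Lemma computable_exp2 k a : computable k a -> computable k (fun s => 2 ^ a s).
Proof.
move=> Ha.
apply: eq_computable (computable_iter (g := fun z _ => z + z) Ha (computable_const k 1) _).
  by move=> s; elim: (a s) => //= n ->; rewrite addnn -mul2n expnS.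
by computability.
Qed.
Hint Resolve computable_exp2 : recursive.

Lemma computable_odd k a : computable k a -> computable k (fun s => odd (a s)).
Proof.
move=> Ha.
apply: eq_computable (computable_iter (g := fun z _ => 1 - z) Ha (computable_const k 0) _).
  by move=> s; elim: (a s) => //= n ->; case: odd.
by computability.
Qed.
Hint Resolve computable_odd : recursive.

(** Primitive recursion by [n.+1./2 = n - n./2]. *)
Lemma computable_half k a : computable k a -> computable k (fun s => (a s)./2).
Proof.
move=> Ha.
apply: eq_computable (computable_rec (g := fun n z _ => n - z) Ha (computable_const k 0) _).
  move=> s; elim: (a s) => //= n ->; rewrite uphalf_half.
  by rewrite -{1}(odd_double_half n) -addnn addnA addnK.
by computability.
Qed.
Hint Resolve computable_half : recursive.

Lemma computable_negb k (P : seq nat -> bool) :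
  computable k (fun s => P s) -> computable k (fun s => ~~ P s).
Proof.
move=> HP; have : computable k (fun s => 1 - P s) by computability.
by apply: eq_computable => s; case: (P s).
Qed.

Lemma computable_andb k (P Q : seq nat -> bool) :
    computable k (fun s => P s) -> computable k (fun s => Q s) ->
  computable k (fun s => P s && Q s).
Proof.
move=> HP HQ; have : computable k (fun s => P s * Q s) by computability.
by apply: eq_computable => s; rewrite mulnb.
Qed.

Lemma computable_leq k a b : computable k a -> computable k b ->
  computable k (fun s => a s <= b s).
Proof.
move=> Ha Hb; have : computable k (fun s => 1 - (a s - b s)) by computability.
by apply: eq_computable => s; rewrite -subn_eq0; case: (a s - b s).
Qed.
Hint Resolve computable_negb computable_andb computable_leq : recursive.

Lemma computable_eq k a b : computable k a -> computable k b ->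
  computable k (fun s => a s == b s).
Proof.
move=> Ha Hb.
have : computable k (fun s => (a s <= b s) && (b s <= a s)) by computability.
by apply: eq_computable => s; rewrite eqn_leq.
Qed.
Hint Resolve computable_eq : recursive.

Lemma computable_orb k (P Q : seq nat -> bool) :
    computable k (fun s => P s) -> computable k (fun s => Q s) ->
  computable k (fun s => P s || Q s).
Proof.
move=> HP HQ; have : computable k (fun s => ~~ (~~ P s && ~~ Q s)) by computability.
by apply: eq_computable => s; rewrite negb_and !negbK.
Qed.
Hint Resolve computable_orb : recursive.

Lemma computable_if k (P : seq nat -> bool) a b :
    computable k (fun s => P s) -> computable k a -> computable k b ->
  computable k (fun s => if P s then a s else b s).
Proof.
move=> HP Ha Hb.
have : computable k (fun s => P s * a s + ~~ P s * b s) by computability.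
by apply: eq_computable => s; case: (P s); rewrite /= !mul1n ?addn0.
Qed.
Hint Resolve computable_if : recursive.

Definition ball (n : nat) (P : nat -> bool) : bool := all P (iota 0 n).

Lemma ballP n (P : nat -> bool) :
  reflect (forall i, i < n -> P i) (ball n P).
Proof.
apply: (iffP allP) => H i; first by move=> lt_i; apply: H; rewrite mem_iota.
by rewrite mem_iota => /andP[_ /H].
Qed.

Lemma computable_ball k a (P : nat -> seq nat -> bool) : computable k a ->
    computable k.+2 (fun s => P (nth 0 s 0) (behead (behead s))) ->
  computable k (fun s => ball (a s) (P^~ s)).
Proof.
move=> Ha HP.
have : computable k
    (fun s => nat_rect (fun=> nat) 1 (fun n z => P n s * z) (a s)).
  by apply: (computable_rec (g := fun n z s => P n s * z)); computability.
apply: eq_computable => s; rewrite /ball.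
elim: (a s) => // n IHn; have -> : iota 0 n.+1 = rcons (iota 0 n) n by rewrite -addn1 iotaD cats1.
by rewrite all_rcons /= IHn mulnb.
Qed.

(** * Arithmetic of codes of lists *)

(** The code of a list with head [a] whose tail has code [c]: [a] is the 2-adic valuation, and [c]
    is the odd part halved and rounded down. *)
Definition consc (a c : nat) : nat := 2 ^ a * c.*2.+1.

Lemma code_cons a s : CodeSeq.code (a :: s) = consc a (CodeSeq.code s).
Proof. by []. Qed.

Lemma computable_cons k a b : computable k a -> computable k b ->
  computable k (fun s => consc (a s) (b s)).
Proof.
move=> Ha Hb.
have : computable k (fun s => 2 ^ a s * (b s + b s).+1) by computability.
by apply: eq_computable => s; rewrite addnn.
Qed.
Hint Resolve computable_cons : recursive.

(** The 2-adic valuation: [z] grows until [c] halved [z] times is odd. For positive [c], [c] rounds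
    suffice because [2 ^ a] exceeds [a]; for [c = 0] the halves are never odd, but no round is
    made. *)
Definition headc (c : nat) : nat :=
  iter c (fun z => if odd (iter z half c) then z else z.+1) 0.

Definition behc (c : nat) : nat := (iter (headc c) half c)./2.

Lemma iter_half a b c : a <= b -> iter a half (2 ^ b * c) = 2 ^ (b - a) * c.
Proof.
elim: a => [|a IHa] lt_ab; first by rewrite subn0.
rewrite iterS IHa 1?ltnW // -[in LHS](prednK (n := b - a)) ?subn_gt0 //.
by rewrite expnS -mulnA mul2n doubleK subnS.
Qed.

Lemma headc_cons a c : headc (consc a c) = a.
Proof.
rewrite /headc; set f := fun z => _.
have lt_a : a <= consc a c.
  by rewrite (leq_trans (ltnW (ltn_expl a (ltnSn 1)))) // leq_pmulr.
(* The counter rises by one per round and stays put once it has reached the exponent [a]. *)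
have Hf n : iter n f 0 = minn n a.
  elim: n => [|n IHn]; first by rewrite min0n.
  rewrite iterS {}IHn /f iter_half ?geq_minr // oddM oddX /= odd_double orbF andbT.
  rewrite subn_eq0; case: (leqP a n) => [le_an|lt_na].
    by rewrite leqnn (minn_idPr (leqW le_an)).
  by rewrite leqNgt lt_na (minn_idPl lt_na).
by rewrite Hf; apply/minn_idPr.
Qed.

Lemma behc_cons a c : behc (consc a c) = c.
Proof. by rewrite /behc headc_cons iter_half // subnn mul1n /= uphalf_double. Qed.

Lemma computable_head k a : computable k a -> computable k (fun s => headc (a s)).
Proof.
apply: (computable_comp1 (f := fun s => headc (nth 0 s 0))) => {k a}.
apply: (computable_iter
  (g := fun z s => if odd (iter z half (nth 0 s 0)) then z else z.+1));
  computability.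
apply: computable_if; computability.
apply: computable_odd; apply: (computable_iter (g := fun z _ => half z)); computability.
Qed.
Hint Resolve computable_head : recursive.

Lemma computable_behc k a : computable k a -> computable k (fun s => behc (a s)).
Proof.
apply: (computable_comp1 (f := fun s => behc (nth 0 s 0))) => {k a}.
apply: computable_half; apply: (computable_iter (g := fun z _ => half z)); computability.
Qed.
Hint Resolve computable_behc : recursive.

Notation dec := CodeSeq.decode.

Lemma headcE c : headc c = head 0 (dec c).
Proof.
rewrite -{1}(CodeSeq.decodeK c); case: (dec c) => [|a s] //.
exact: headc_cons.
Qed.

Lemma behcE c : dec (behc c) = behead (dec c).
Proof.
rewrite -{1}(CodeSeq.decodeK c); case: (dec c) => [|a s] //.
by rewrite code_cons behc_cons CodeSeq.codeK.
Qed.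

Definition dropc (i c : nat) : nat := iter i behc c.

Lemma dropcE i c : dec (dropc i c) = drop i (dec c).
Proof.
elim: i => [|i IHi] /=; first by rewrite drop0.
by rewrite behcE IHi -drop1 drop_drop add1n.
Qed.

Lemma computable_dropc k a b : computable k a -> computable k b ->
  computable k (fun s => dropc (a s) (b s)).
Proof.
by move=> Ha Hb; apply: (computable_iter (g := fun z _ => behc z)) => //; computability.
Qed.
Hint Resolve computable_dropc : recursive.

Definition nthc (c i : nat) : nat := headc (dropc i c).

Lemma nthcE c i : nthc c i = nth 0 (dec c) i.
Proof. by rewrite /nthc headcE dropcE -nth0 nth_drop addn0. Qed.

Lemma nthc_code s i : nthc (CodeSeq.code s) i = nth 0 s i.
Proof. by rewrite nthcE CodeSeq.codeK. Qed.

Lemma computable_nthc k a b : computable k a -> computable k b ->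
  computable k (fun s => nthc (a s) (b s)).
Proof. by rewrite /nthc; computability. Qed.
Hint Resolve computable_nthc : recursive.

(** A code thus bounds the length of its own list, so loops over the list can use it as their number
    of rounds. *)
Lemma size_dec c : size (dec c) <= c.
Proof.
rewrite -{2}(CodeSeq.decodeK c); elim: (dec c) => //= a s IHs.
apply: leq_ltn_trans IHs _; rewrite (leq_trans _ (leq_pmull _ _)) ?expn_gt0 //.
by rewrite ltnS -addnn leq_addr.
Qed.

Lemma dec_eq0 c : (c == 0) = nilp (dec c).
Proof. by rewrite -{1}(CodeSeq.decodeK c); case: (dec c) => // a s; rewrite muln_eq0 expn_eq0. Qed.

(** Round [i] treats entry [i]. There are [c] rounds, at least as many as entries; those past the
    end leave the accumulator alone. *)
Definition foldc (F : nat -> nat -> nat) (z c : nat) : nat :=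
  nat_rect (fun=> nat) z
    (fun i acc => if dropc i c == 0 then acc else F acc (nthc c i)) c.

Lemma foldcE F z c : foldc F z c = foldl F z (dec c).
Proof.
rewrite /foldc.
set G := fun i acc => if dropc i c == 0 then acc else F acc (nthc c i).
suff H n : nat_rect (fun=> nat) z G n = foldl F z (take n (dec c)).
  by rewrite H take_oversize ?size_dec.
elim: n => [|n IHn]; first by rewrite take0.
rewrite /= {1}/G dec_eq0 dropcE nthcE IHn /nilp size_drop subn_eq0.
case: leqP => [le_n|lt_n]; first by rewrite !take_oversize // (leq_trans le_n).
by rewrite (take_nth 0) // foldl_rcons.
Qed.

Lemma computable_behead k f :
  computable k f -> computable k.+1 (fun s => f (behead s)).
Proof.
move=> [p Hp]; exists (RComp p [seq RProj i | i <- iota 1 k]) => s sz.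
apply: (c_comp (ys := behead s)); last by apply: Hp; rewrite size_behead sz.
by have := computes_proj 1 s; rewrite sz subn1 drop1.
Qed.

Lemma computable_foldc k (F : nat -> nat -> seq nat -> nat) a b :
    computable k a -> computable k b ->
    computable k.+2 (fun s => F (nth 0 s 1)
      (nthc (b (behead (behead s))) (nth 0 s 0)) (behead (behead s))) ->
  computable k (fun s => foldc (fun x y => F x y s) (a s) (b s)).
Proof.
move=> Ha Hb HF; apply: (computable_rec
  (g := fun i z s => if dropc i (b s) == 0 then z else F z (nthc (b s) i) s)) => //.
have Hb2 := computable_behead (computable_behead Hb); computability.
Qed.

Definition catrevc (v w : nat) : nat := foldc (fun acc l => consc l acc) w v.

Lemma catrevcE v w : dec (catrevc v w) = catrev (dec v) (dec w).
Proof.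
rewrite /catrevc foldcE -[in RHS](CodeSeq.codeK (dec w)) CodeSeq.decodeK.
elim: (dec v) w => [|l s IHs] w //=.
by rewrite IHs -[in LHS](CodeSeq.decodeK w) -code_cons CodeSeq.codeK.
Qed.

Lemma computable_catrevc k a b : computable k a -> computable k b ->
  computable k (fun s => catrevc (a s) (b s)).
Proof.
apply: computable_comp2.
by apply: (computable_foldc (F := fun x y _ => consc y x)); computability.
Qed.
Hint Resolve computable_catrevc : recursive.

Definition catc (v w : nat) : nat := catrevc (catrevc v 0) w.

Lemma catcE v w : dec (catc v w) = dec v ++ dec w.
Proof. by rewrite /catc !catrevcE /= catrevE revK. Qed.

Lemma computable_catc k a b : computable k a -> computable k b ->
  computable k (fun s => catc (a s) (b s)).
Proof. by rewrite /catc; computability. Qed.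
Hint Resolve computable_catc : recursive.

Definition allc (P : nat -> bool) (c : nat) : bool :=
  ball c (fun i => (dropc i c == 0) || P (nthc c i)).

Lemma allcE P c : allc P c = all P (dec c).
Proof.
apply/ballP/(all_nthP 0) => H i lt_i.
  have:= H i (leq_trans lt_i (size_dec c)).
  by rewrite dec_eq0 dropcE nthcE /nilp size_drop subn_eq0 leqNgt lt_i.
rewrite dec_eq0 dropcE nthcE /nilp size_drop subn_eq0.
by case: leqP => //; apply: H.
Qed.

(** * Coset tables *)

(* A certificate lists a coset table (the row of a point gives its images
   under all the letters), words leading from the base point 0 to each point,
   and the number of points. *)
Definition tablec (c : nat) : nat := nthc c 0.
Definition transc (c i : nat) : nat := nthc (nthc c 1) i.
Definition sizec (c : nat) : nat := nthc c 2.

Definition actc (c i j : nat) : nat := nthc (nthc (tablec c) i) j.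
Definition runc (c i w : nat) : nat := foldc (actc c) i w.
(** Inversion of a letter: the last bit of its code is the sign. *)
Definition flipc (l : nat) : nat := if odd l then l.-1 else l.+1.
(** Consing during a left fold reverses the word, as inversion requires. *)
Definition invc (w : nat) : nat := foldc (fun acc l => consc (flipc l) acc) 0 w.

(** A Schreier generator: go from the base point to [i], read the letter [j], and return from the
    point reached along its own word. *)
Definition schreierc (c i j : nat) : nat :=
  catc (transc c i) (consc j (invc (transc c (actc c i j)))).

Definition gensc (N c : nat) : nat :=
  nat_rect (fun=> nat) 0 (fun i acc =>
    nat_rect (fun=> nat) acc (fun j acc => consc (schreierc c i j) acc) N)
  (sizec c).

(** Here [N] counts the letters with signs, [R] codes the relators, and [x] codes [g] followed by
    the generators of [H]. The codes [R] and [x] also serve as loop bounds: entries past the end of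
    a list read as 0, the empty word, which fixes every point. *)
Definition certifies (N R c x : nat) : bool :=
  [&& 0 < sizec c,
      ball (sizec c) (fun i => ball N (fun j =>
        (actc c i j < sizec c) && (actc c (actc c i j) (flipc j) == i))),
      ball (sizec c) (fun i => ball R (fun k => runc c i (nthc R k) == i)),
      transc c 0 == 0,
      ball (sizec c) (fun i =>
        allc (leq^~ N \o S) (transc c i) && (runc c 0 (transc c i) == i)),
      ball x (fun k => runc c 0 (nthc x k.+1) == 0)
    & runc c 0 (nthc x 0) != 0].

Lemma computable_tablec k a : computable k a -> computable k (fun s => tablec (a s)).
Proof. by rewrite /tablec; computability. Qed.
Lemma computable_sizec k a : computable k a -> computable k (fun s => sizec (a s)).
Proof. by rewrite /sizec; computability. Qed.
Lemma computable_transc k a b : computable k a -> computable k b ->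
  computable k (fun s => transc (a s) (b s)).
Proof. by rewrite /transc; computability. Qed.
Hint Resolve computable_tablec computable_sizec computable_transc : recursive.

Lemma computable_actc k a b c : computable k a -> computable k b ->
  computable k c -> computable k (fun s => actc (a s) (b s) (c s)).
Proof. by rewrite /actc; computability. Qed.
Hint Resolve computable_actc : recursive.

Lemma computable_runc k a b c : computable k a -> computable k b ->
  computable k c -> computable k (fun s => runc (a s) (b s) (c s)).
Proof.
apply: computable_comp3.
by apply: (computable_foldc (F := fun i l s => actc (nth 0 s 0) i l)); computability.
Qed.
Hint Resolve computable_runc : recursive.

Lemma computable_flipc k a : computable k a -> computable k (fun s => flipc (a s)).
Proof. by rewrite /flipc; computability. Qed.
Hint Resolve computable_flipc : recursive.

Lemma computable_invc k a : computable k a -> computable k (fun s => invc (a s)).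
Proof.
apply: (computable_comp1 (f := fun s => invc (nth 0 s 0))).
by apply: (computable_foldc (F := fun acc l _ => consc (flipc l) acc)); computability.
Qed.
Hint Resolve computable_invc : recursive.

Lemma computable_schreierc k a b c : computable k a -> computable k b ->
  computable k c -> computable k (fun s => schreierc (a s) (b s) (c s)).
Proof. by rewrite /schreierc; computability. Qed.
Hint Resolve computable_schreierc : recursive.

Lemma computable_gensc N : computable 1 (fun s => gensc N (nth 0 s 0)).
Proof.
apply: (computable_rec (g := fun i acc s => nat_rect (fun=> nat) acc
  (fun j acc => consc (schreierc (nth 0 s 0) i j) acc) N)); computability.
apply: (computable_rec (g := fun j acc s =>
  consc (schreierc (nth 0 (behead (behead s)) 0) (nth 0 s 0) j) acc)); computability.
Qed.

Lemma computable_certifies N R :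
  computable 2 (fun s => certifies N R (nth 0 s 0) (nth 0 s 1)).
Proof.
by rewrite /certifies /allc /=; repeat apply: computable_andb;
  repeat first [apply: computable_ball | apply: computable_andb | apply: computable_orb];
  computability.
Qed.

Lemma genscE N c : dec (gensc N c) =
  rev [seq schreierc c i j | i <- iota 0 (sizec c), j <- iota 0 N].
Proof.
have iotaSr n : iota 0 n.+1 = rcons (iota 0 n) n by rewrite -addn1 iotaD cats1.
have inner i acc : dec (nat_rect (fun=> nat) acc
    (fun j acc => consc (schreierc c i j) acc) N) =
    rev [seq schreierc c i j | j <- iota 0 N] ++ dec acc.
  elim: N => [|N' IHN] //; rewrite iotaSr map_rcons rev_rcons /= -IHN.
  by rewrite -[in LHS](CodeSeq.decodeK (nat_rect _ _ _ N')) -code_cons CodeSeq.codeK.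
rewrite /gensc; elim: (sizec c) => [|n IHn] //.
rewrite iotaSr /= inner IHn -cats1 map_cat flatten_cat rev_cat /=.
by rewrite cats0.
Qed.

(** * Codes of letters and words *)

Section Words.
Variables (X : finType).
Implicit Types (u v w : word X) (l : X * bool).

Lemma letter_code_inj : injective (@letter_code X).
Proof.
move=> [x b] [y b'] /eqP; rewrite /letter_code /= => /eqP E.
have Eb : b = b' by move: (congr1 odd E); rewrite !oddD !odd_double; case: b b' {E} => [] [].
subst b'; congr (_, _); apply: enum_rank_inj; apply: val_inj => /=.
by move/addIn/double_inj: E.
Qed.

Lemma letter_code_lt l : letter_code l < #|X|.*2.
Proof.
case: l => x b; rewrite /letter_code /=.
apply: (@leq_trans (enum_rank x).+1.*2); rewrite ?leq_double // doubleS.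
by case: b; rewrite ?addn1 ?addn0.
Qed.

Lemma letter_code_surj j : j < #|X|.*2 -> exists l, letter_code l = j.
Proof.
move=> lt_j; have lt_h : j./2 < #|X|.
  by rewrite ltnNge -leq_double -ltnNge (leq_ltn_trans _ lt_j) // -{2}(odd_double_half j) leq_addl.
exists (enum_val (Ordinal lt_h), odd j).
by rewrite /letter_code /= enum_valK /= addnC odd_double_half.
Qed.

Lemma letter_code_flip (x : X) b : letter_code (x, ~~ b) = flipc (letter_code (x, b)).
Proof.
by rewrite /letter_code /flipc /= oddD odd_double /=; case: b; rewrite /= ?addn1 ?addn0.
Qed.

Lemma word_code_inj : injective (@word_code X).
Proof. by move=> u v /(can_inj CodeSeq.codeK) /(inj_map letter_code_inj). Qed.

(** Lets the numerical words of a certificate be read as genuine words over [X]. *)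
Lemma word_code_surj c :
  all (leq^~ #|X|.*2 \o S) (dec c) -> exists w, word_code w = c.
Proof.
move=> Hc; suff [w Hw] : exists w : word X, [seq letter_code l | l <- w] = dec c.
  by exists w; rewrite /word_code Hw CodeSeq.decodeK.
elim: (dec c) Hc => [|j s IHs] /=; first by exists [::].
by case/andP => /letter_code_surj[l <-] /IHs[w <-]; exists (l :: w).
Qed.

Lemma word_code_cat u v : word_code (u ++ v) = catc (word_code u) (word_code v).
Proof.
apply: (can_inj CodeSeq.decodeK).
by rewrite catcE !CodeSeq.codeK map_cat.
Qed.

Lemma word_code_inv w : word_code (inv_word w) = invc (word_code w).
Proof.
rewrite /invc foldcE CodeSeq.codeK /inv_word.
elim/last_ind: w => [|w [x b] IHw] //.
by rewrite rev_rcons !map_rcons foldl_rcons -IHw -letter_code_flip.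
Qed.

Lemma runc_word c i w : runc c i (word_code w) =
  foldl (fun i l => actc c i (letter_code l)) i w.
Proof.
rewrite /runc foldcE CodeSeq.codeK.
by elim: w i => //= l w IHw i; rewrite IHw.
Qed.

(** This holds past the end of the list too, because the empty word has code 0. *)
Lemma nthc_words_code (ws : seq (word X)) k :
  nthc (words_code ws) k = word_code (nth [::] ws k).
Proof.
rewrite nthc_code; case: (ltnP k (size ws)) => lt_k; first by rewrite (nth_map [::]).
by rewrite !nth_default ?size_map.
Qed.

Lemma size_words_code (ws : seq (word X)) : size ws <= words_code ws.
Proof. by rewrite -(size_map (@word_code X)) -[X in size X]CodeSeq.codeK size_dec. Qed.

End Words.

(** * Words and presentations *)

Local Open Scope group_scope.

Section Evaluation.
Variables (X : Type) (G : groupType) (e : X -> G).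

Lemma weval_nil : weval e [::] = 1.
Proof. by rewrite /weval big_nil. Qed.

Lemma weval_cons l w :
  weval e (l :: w) = (if l.2 then (e l.1)^-1 else e l.1) * weval e w.
Proof. by rewrite /weval big_cons. Qed.

Lemma weval_cat u v : weval e (u ++ v) = weval e u * weval e v.
Proof. by rewrite /weval big_cat. Qed.

Lemma weval_inv w : weval e (inv_word w) = (weval e w)^-1.
Proof.
elim: w => [|[x b] w IHw]; first by rewrite weval_nil invg1.
rewrite /inv_word rev_cons map_rcons -cats1 weval_cat -/(inv_word w) IHw.
by rewrite !weval_cons /= weval_nil mulg1 invMg; case: b; rewrite ?invgK.
Qed.

Lemma weval_cancel x b w : weval e ((x, b) :: (x, ~~ b) :: w) = weval e w.
Proof. by rewrite !weval_cons; case: b; rewrite /= ?mulKg ?mulVKg. Qed.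

End Evaluation.

Lemma weval_map (X Y : Type) (G : groupType) (e : Y -> G) (f : X -> Y) w :
  weval e (map_word f w) = weval (e \o f) w.
Proof. by rewrite /weval big_map. Qed.

Lemma weval_morph (X : Type) (G K : groupType) (e : X -> G) (f : G -> K) w :
  {morph f : x y / x * y} -> f (weval e w) = weval (f \o e) w.
Proof.
move=> fM; have f1 : f 1 = 1.
  by apply: (mulgI (f 1)); rewrite -fM !mulg1.
have fV x : f x^-1 = (f x)^-1 by apply: (mulgI (f x)); rewrite -fM !mulgV.
elim: w => [|l w IHw]; first by rewrite !weval_nil.
by rewrite !weval_cons fM IHw /=; case: l.2; rewrite ?fV.
Qed.

Lemma word_equiv_weval (X : eqType) (R : seq (word X)) (G : groupType)
    (e : X -> G) : (forall r, r \in R -> weval e r = 1) ->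
  forall u v, word_equiv R u v -> weval e u = weval e v.
Proof.
move=> eR u v; elim=> {u v} [//|u v _ -> //|u v w _ -> _ -> //|u v x b|u v r Rr].
  by rewrite !weval_cat weval_cancel.
by rewrite !weval_cat (eR r Rr) mul1g.
Qed.

Lemma presents_relator (X : eqType) (R : seq (word X)) (G : groupType)
    (e : X -> G) r : presents R e -> r \in R -> weval e r = 1.
Proof.
by case=> _ eP Rr; apply/eP; have := we_relator [::] [::] Rr; rewrite /= cats0.
Qed.

(** Von Dyck's theorem. Words with equal values in [G] differ by relators, which [f] kills; so [F]
    may evaluate [f] on any chosen word for its argument. *)
Lemma presents_morph (X : eqType) (R : seq (word X)) (G K : groupType)
    (e : X -> G) (f : X -> K) :
    presents R e -> (forall r, r \in R -> weval f r = 1) ->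
  exists2 F : G -> K, {morph F : x y / x * y}
    & forall w, F (weval e w) = weval f w.
Proof.
move=> [e_onto eP] fR.
have e_f u v : weval e u = weval e v -> weval f u = weval f v.
  move=> euv; apply/divg1_eq; rewrite -weval_inv -weval_cat -(weval_nil f).
  apply: (word_equiv_weval fR); apply/eP.
  by rewrite weval_cat weval_inv euv mulgV.
have [wd wdP] := choice e_onto.
have F_e w : weval f (wd (weval e w)) = weval f w by apply: e_f.
exists (weval f \o wd) => // x y /=.
by rewrite -weval_cat -[RHS]F_e weval_cat !wdP.
Qed.

Lemma generated_subgroup (G : groupType) (S : seq G) : is_subgroup (generated S).
Proof.
split=> [K [] //|x y Hx Hy K sgK SK|x Hx K sgK SK].
  by case: (sgK) => _ KM _; apply: KM; [apply: Hx | apply: Hy].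
by case: (sgK) => _ _ KV; apply: KV; apply: Hx.
Qed.

Lemma generated_mem (G : groupType) (S : seq G) s : s \in S -> generated S s.
Proof. by move=> Ss K _; apply. Qed.

(** Serves to turn a list of codes into a list of words. [P] is stated by position because [T]
    carries no decidable equality. *)
Lemma seq_preimage (T : Type) (T' : eqType) (f : T -> T') (P : T -> Prop) (s : seq T') :
    (forall y, y \in s -> exists2 x, f x = y & P x) ->
  exists2 r, [seq f x | x <- r] = s & forall i x0, i < size r -> P (nth x0 r i).
Proof.
elim: s => [|y s IHs] Hs; first by exists [::].
have [x <- Px] := Hs y (mem_head _ _).
have [|r <- Pr] := IHs; first by move=> z sz; apply: Hs; rewrite inE sz orbT.
by exists (x :: r) => // [[|i]] x0 //= /Pr.
Qed.

(** * Soundness: a certified coset table yields a separating subgroup *)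

Section Soundness.
Variables (X : finType) (R : seq (word X)) (G : groupType) (e : X -> G).
Hypothesis presG : presents R e.
Variables (hs : seq (word X)) (g : word X) (c : nat).
Let N := #|X|.*2.
Hypothesis c_ok : certifies N (words_code R) c (words_code (g :: hs)).
Let n := sizec c.
Let move i (l : X * bool) := actc c i (letter_code l).
Let run i (w : word X) := foldl move i w.

Let run_cat i u v : run i (u ++ v) = run (run i u) v.
Proof. exact: foldl_cat. Qed.

Let move_lt i l : i < n -> move i l < n.
Proof.
case/and5P: c_ok => _ /ballP act_ok _ _ _ /act_ok/ballP/(_ _ (letter_code_lt l)).
by case/andP.
Qed.

Let moveK i x b : i < n -> move (move i (x, b)) (x, ~~ b) = i.
Proof.
case/and5P: c_ok => _ /ballP act_ok _ _ _ /act_ok/ballP.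
by move=> /(_ _ (letter_code_lt (x, b)))/andP[_ /eqP]; rewrite /move letter_code_flip.
Qed.

Let run_lt i w : i < n -> run i w < n.
Proof. by elim: w i => //= l w IHw i /(move_lt l)/IHw. Qed.

(** The certificate makes inverse letters cancel and relators act trivially at every point of the
    table, hence also in the middle of a word. *)
Let run_equiv u v : word_equiv R u v -> forall i, i < n -> run i u = run i v.
Proof.
elim=> {u v} // [u v _ IH i /IH ->|u v w _ IHu _ IHv i lt_i|u v x b i lt_i|u v r Rr i lt_i] //.
- by rewrite IHu // IHv.
- by rewrite !run_cat {2}/run /= moveK //; apply: run_lt.
rewrite !run_cat; congr run.
case/and5P: c_ok => _ _ /ballP rel_ok _ _.
have lt_r : index r R < words_code R.
  by rewrite (leq_trans _ (size_words_code R)) ?index_mem.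
have /ballP/(_ _ lt_r)/eqP := rel_ok _ (run_lt u lt_i).
by rewrite nthc_words_code nth_index // runc_word.
Qed.

Let run_inv i w : i < n -> run (run i w) (inv_word w) = i.
Proof.
elim/last_ind: w => [|w [x b] IHw] // lt_i.
rewrite /inv_word rev_rcons /= /run foldl_rcons /= moveK; last exact: run_lt.
exact: IHw.
Qed.

(** The table thus describes a right action of [G]: words of equal value differ by relators, so they
    lead to the same point. *)
Let run_weval u v i : i < n -> weval e u = weval e v -> run i u = run i v.
Proof.
move=> lt_i euv; have /run_equiv/(_ _ (run_lt v lt_i)) : word_equiv R (inv_word v ++ u) [::].
  by apply/presG.2; rewrite weval_cat weval_inv euv mulVg.
by rewrite run_cat run_inv.
Qed.

Let size_gt0 : 0 < n. Proof. by case/andP: c_ok. Qed.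

(** The Schreier generators generate exactly the stabiliser of the point 0, whose index is at most
    the number of points and which contains [H] but not [g]. *)
Lemma certifies_separating : exists2 ks,
  gensc N c = words_code ks &
  separating (generated [seq weval e h | h <- hs]) (weval e g)
    (generated [seq weval e k | k <- ks]).
Proof.
case/and5P: (c_ok) => _ _ _ /eqP t0 /and3P[/ballP t_ok /ballP hs_ok g_ok].
have t_ex i : exists t : word X, i < n -> word_code t = transc c i /\ run 0 t = i.
  case: (ltnP i n) => [lt_i|_]; last by exists [::].
  have /andP[] := t_ok i lt_i; rewrite allcE => /word_code_surj[w <-].
  by rewrite runc_word => /eqP; exists w.
have [t tP] := choice t_ex.
have t_code i : i < n -> word_code (t i) = transc c i by case/tP.
have t_run i : i < n -> run 0 (t i) = i by case/tP.
have t0E : t 0 = [::] by apply: word_code_inj; rewrite t_code.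
pose sch i l := t i ++ l :: inv_word (t (move i l)).
have schE i l : i < n -> word_code (sch i l) = schreierc c i (letter_code l).
  move=> lt_i; rewrite /sch word_code_cat t_code // /schreierc.
  rewrite -[transc c (actc _ _ _)]t_code ?move_lt //.
  by rewrite -word_code_inv.
have [|ks ksE ks_run] := @seq_preimage _ _ (@word_code X) (fun w => run 0 w = 0)
    (dec (gensc N c)).
  move=> y; rewrite genscE mem_rev => /allpairsP[[i j] /= []].
  rewrite !mem_iota => /andP[_ lt_i] /andP[_ /letter_code_surj[l <-]] ->.
  exists (sch i l); first exact: schE.
  rewrite run_cat t_run // [LHS]/= -{1}(t_run (move i l)) ?move_lt //.
  exact: run_inv.
exists ks; first by rewrite /words_code ksE CodeSeq.decodeK.
set K := generated [seq weval e k | k <- ks].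
have [K1 KM KV] : is_subgroup K by apply: generated_subgroup.
have K_sch i l : i < n -> K (weval e (sch i l)).
  move=> lt_i; apply: generated_mem; apply: (map_f (weval e)).
  have: word_code (sch i l) \in [seq word_code k | k <- ks]; last first.
    by case/mapP=> k ks_k /word_code_inj ->.
  rewrite ksE genscE mem_rev schE //.
  by apply: (allpairs_f (schreierc c)); rewrite mem_iota ?letter_code_lt.
(* Schreier's lemma, by induction on the last letter: each new letter contributes one Schreier
   generator. *)
have K_run w : K (weval e w * (weval e (t (run 0 w)))^-1).
  elim/last_ind: w => [|w l IHw]; first by rewrite /= t0E weval_nil mulgV.
  have lt_w := run_lt w size_gt0.
  rewrite /run foldl_rcons -/(run 0 w) -cats1 weval_cat.
  have := KM _ _ IHw (K_sch _ l lt_w).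
  by rewrite /sch weval_cat -cat1s weval_cat weval_inv -!mulgA mulKg.
have K_stab w : run 0 w = 0 -> K (weval e w).
  by move=> w0; have := K_run w; rewrite w0 t0E weval_nil invg1 mulg1.
split.
- exact: generated_subgroup.
- exists [seq (weval e (t i))^-1 | i <- iota 0 n] => x.
  (* Finite index is stated with left cosets, whereas [K_run] speaks of right cosets; hence a word
     for the inverse of [x] and inverted representatives. *)
  have [w w_x] := presG.1 x^-1.
  exists (weval e (t (run 0 w)))^-1.
    by apply: map_f; rewrite mem_iota run_lt.
  have := KV _ (K_run w).
  by rewrite w_x invgF !invgK.
- move=> x Hx; apply: Hx; first exact: generated_subgroup.
  move=> _ /mapP[h hs_h ->]; apply: K_stab.
  have lt_h : index h hs < words_code (g :: hs).
    by apply: leq_trans (size_words_code _); rewrite ltnS index_size.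
  have := hs_ok _ lt_h.
  by rewrite nthc_words_code /= nth_index // runc_word => /eqP.
move=> Kg; move: g_ok; rewrite nthc_words_code runc_word -/(run 0 g) => /negP; apply; apply/eqP.
suff: forall w, weval e w = weval e g -> run 0 w = 0 by apply.
(* The generated subgroup lies in the stabiliser of 0, expressed here by words: every word for the
   element returns to 0. *)
apply: (Kg (fun x => forall w, weval e w = x -> run 0 w = 0)) => [|_ /mapP[k ks_k ->] w].
  split=> [w|x y Kx Ky w w_xy|x Kx w w_x].
  - by rewrite -(weval_nil e) => /(run_weval size_gt0).
  - have [u u_x] := presG.1 x; have [v v_y] := presG.1 y.
    have /(run_weval size_gt0) -> : weval e w = weval e (u ++ v).
      by rewrite weval_cat u_x v_y.
    by rewrite run_cat Kx // Ky.
  (* Reading the inverse of [w] and then [w] leads back to 0, and by assumption the first half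
     already ends at 0. *)
  have: run (run 0 (inv_word w)) w = 0.
    have := @run_inv 0 (inv_word w) size_gt0.
    rewrite -[X in run _ X = _](_ : w = _) //.
    rewrite /inv_word -map_rev revK -map_comp -[LHS]map_id.
    by apply: eq_map => [[y b]] /=; rewrite negbK.
  by rewrite (Kx (inv_word w)) // weval_inv w_x invgK.
move/(run_weval size_gt0) => ->.
have := ks_run (index k ks) k; rewrite index_mem nth_index //; exact.
Qed.

End Soundness.

(** * Completeness: a finite permutation action gives a certificate *)

Section Completeness.
Variables (X : finType) (R : seq (word X)) (T : finType) (rho : X -> {perm T}).
Variables (x0 : T) (hs : seq (word X)) (g : word X).
Let N := #|X|.*2.

Let pl (l : X * bool) : {perm T} := if l.2 then (rho l.1)^-1 else rho l.1.

(** The table is read off the orbit of [x0]; restricting to the orbit provides a word from the base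
    point to every point. *)
Lemma perm_certifies :
    (forall r, r \in R -> weval rho r = 1) ->
    (forall h, h \in hs -> weval rho h x0 = x0) -> weval rho g x0 <> x0 ->
  exists c, certifies N (words_code R) c (words_code (g :: hs)).
Proof.
move=> rhoR rho_hs rho_g.
pose O := [set y | `[< exists w, weval rho w x0 = y >]].
have OP y : reflect (exists w, weval rho w x0 = y) (y \in O).
  by rewrite inE; apply: asboolP.
have O_x0 : x0 \in O by apply/OP; exists [::]; rewrite weval_nil perm1.
(* The orbit is listed with [x0] first, so that the base point gets number 0. *)
pose s := x0 :: rem x0 (enum O); pose n := size s.
have perm_s : perm_eq (enum O) s by apply: perm_to_rem; rewrite mem_enum.
have mem_s y : (y \in s) = (y \in O) by rewrite -(perm_mem perm_s) mem_enum.
have uniq_s : uniq s by rewrite -(perm_uniq perm_s) enum_uniq.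
have s_pl l y : y \in s -> pl l y \in s.
  rewrite !mem_s => /OP[w <-]; apply/OP; exists (w ++ [:: l]).
  by rewrite weval_cat weval_cons weval_nil mulg1 permM.
(* Table columns are numbers: [j] acts as the letter it codes, with the identity as a dummy if there
   is none. *)
pose F j : {perm T} := if [pick l : X * bool | letter_code l == j] is Some l then pl l else 1.
have F_l l : F (letter_code l) = pl l.
  rewrite /F; case: pickP => [l' /eqP/letter_code_inj -> //|/(_ l)].
  by rewrite eqxx.
have t_ex i : exists w : word X, i < n -> weval rho w x0 = nth x0 s i.
  case: (ltnP i n) => [lt_i|_]; last by exists [::].
  by have := mem_nth x0 lt_i; rewrite mem_s => /OP[w Hw]; exists w.
have [t0 t0P] := choice t_ex.
(* The chosen word for the base point might be a nontrivial loop, but a certificate demands the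
   empty word there. *)
pose t i := if i == 0 then [::] else t0 i.
have tP i : i < n -> weval rho (t i) x0 = nth x0 s i.
  by rewrite /t; case: eqP => [-> _|_ /t0P //]; rewrite weval_nil perm1.
pose row i := CodeSeq.code (mkseq (fun j => index (F j (nth x0 s i)) s) N).
pose c := CodeSeq.code [:: CodeSeq.code (mkseq row n);
  CodeSeq.code (mkseq (@word_code X \o t) n); n].
have sizeE : sizec c = n by rewrite /sizec nthc_code.
have transE i : i < n -> transc c i = word_code (t i).
  by move=> lt_i; rewrite /transc !nthc_code nth_mkseq.
have actE i l : i < n -> actc c i (letter_code l) = index (pl l (nth x0 s i)) s.
  move=> lt_i; rewrite /actc /tablec !nthc_code /= nth_mkseq // /row nthc_code.
  by rewrite nth_mkseq ?letter_code_lt // F_l.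
have act_index y l : y \in s -> actc c (index y s) (letter_code l) = index (pl l y) s.
  by move=> s_y; rewrite actE ?index_mem // nth_index.
have run_index y w : y \in s -> runc c (index y s) (word_code w) = index (weval rho w y) s.
  rewrite runc_word; elim: w y => [|l w IHw] y s_y; first by rewrite weval_nil perm1.
  by rewrite /= act_index // weval_cons permM IHw ?s_pl.
have run0 w : runc c 0 (word_code w) = index (weval rho w x0) s.
  by rewrite -run_index ?mem_head //= eqxx.
have index_nthK i : i < n -> index (nth x0 s i) s = i by move=> lt_i; apply: index_uniq.
exists c; rewrite /certifies sizeE; apply/and5P; split; [by [] | | | | apply/and3P; split].
- apply/ballP => i lt_i; apply/ballP => _ /letter_code_surj[[x b] <-].
  rewrite actE // index_mem s_pl ?mem_nth //= -letter_code_flip.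
  rewrite act_index ?s_pl ?mem_nth // -{2}(index_nthK i lt_i).
  by rewrite /pl; case: b; rewrite /= ?permK ?permKV.
- apply/ballP => i lt_i; apply/ballP => k _.
  rewrite nthc_words_code -(index_nthK i lt_i) run_index ?mem_nth //.
  case: (ltnP k (size R)) => [lt_k|le_k]; last by rewrite nth_default // weval_nil perm1.
  by rewrite rhoR ?mem_nth // perm1.
- by rewrite transE.
- apply/ballP => i lt_i; rewrite transE // run0 tP // index_nthK // eqxx andbT.
  rewrite allcE CodeSeq.codeK; apply/allP => _ /mapP[l _ ->].
  exact: letter_code_lt.
- apply/ballP => k _; rewrite nthc_words_code run0 /=.
  case: (ltnP k (size hs)) => [lt_k|le_k]; last by rewrite nth_default // weval_nil perm1 eqxx.
  by rewrite rho_hs ?mem_nth //= eqxx.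
by rewrite nthc_words_code run0 /=; case: (x0 =P _) => // /esym.
Qed.

End Completeness.
(** * Residual properties of amalgams of finite groups *)

(** Each [x] splits into a representative [r x] of its left coset modulo the image of [A] and a
    coordinate [p x] in [A]. Right translation by [A] changes only the coordinate, which makes the
    freeness of this action explicit. *)
Lemma coset_section (A K : finGroupType) (phi : {morphism [set: A] >-> K}) :
    'injm phi ->
  exists (r : K -> K) (p : K -> A),
    [/\ forall x, x = r x * phi (p x),
        forall x a, r (x * phi a) = r x, forall x a, p (x * phi a) = p x * a,
        forall x a, r (r x * phi a) = r x & forall x a, p (r x * phi a) = a].
Proof.
move=> inj; pose B := (phi @* [set: A])%G.
have phiB a : phi a \in B by rewrite mem_morphim ?inE.
pose r x := repr (x *: B); pose p x := invm inj ((r x)^-1 * x).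
have r_B x : (r x)^-1 * x \in B.
  have /lcosetP[b Bb rE] : r x \in x *: B by apply: (mem_repr x); rewrite lcoset_refl.
  by rewrite rE invMg mulgVK groupV.
have phi_p x : phi (p x) = (r x)^-1 * x by rewrite /p invmK.
have r_phi x a : r (x * phi a) = r x by rewrite /r lcosetM lcoset_id.
have rE x : r x = x * phi (p x)^-1 by rewrite morphV ?inE // phi_p invMg mulKVg invgK.
have p_phi x a : p (x * phi a) = p x * a.
  apply: (injmP inj); rewrite ?inE //.
  by rewrite morphM ?inE // !phi_p r_phi mulgA.
have r_r x a : r (r x * phi a) = r x by rewrite r_phi {1}(rE x) r_phi.
exists r, p; split=> // x => [|a]; first by rewrite phi_p mulKVg.
by rewrite p_phi (rE x) p_phi mulgV mul1g.
Qed.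

(** * Right cosets and partial actions on finitely many of them *)

Section RightCosets.
Variables (G : groupType) (H : G -> Prop).
Hypothesis sgH : is_subgroup H.

(** The right coset of [x] is encoded by a canonical element of it, so that finite sets of cosets
    become lists in [G]. *)
Definition coset_rep (x : G) : G := choose (fun y => `[< H (x * y^-1) >]) x.

Lemma coset_rep_eq x y : H (x * y^-1) -> coset_rep x = coset_rep y.
Proof.
case: sgH => H1 HM HV Hxy; have Hyx : H (y * x^-1) by rewrite -invgF; apply: HV.
rewrite /coset_rep (@eq_choose _ _ (fun z => `[< H (y * z^-1) >])) => [|z].
  by apply: choose_id; apply/asboolP => //; rewrite mulgV.
apply/asboolP/asboolP => Hz.
  by have := HM _ _ Hyx Hz; rewrite -mulgA mulKg.
by have := HM _ _ Hxy Hz; rewrite -mulgA mulKg.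
Qed.

Lemma coset_repP x : H (x * (coset_rep x)^-1).
Proof.
by case: sgH => H1 _ _; apply/asboolP; apply: (@chooseP _ (fun y => `[< H (x * y^-1) >]));
  apply/asboolP; rewrite mulgV.
Qed.

Lemma coset_rep_inj x y : coset_rep x = coset_rep y -> H (x * y^-1).
Proof.
case: sgH => _ HM HV exy; have := HM _ _ (coset_repP x) (HV _ (coset_repP y)).
by rewrite invgF exy -mulgA mulKg.
Qed.

Lemma coset_rep_mul x y : coset_rep (coset_rep x * y) = coset_rep (x * y).
Proof.
apply: coset_rep_eq; case: sgH => _ _ HV; have := HV _ (coset_repP x).
by rewrite invgF invMg mulgA mulgK.
Qed.

Lemma coset_repK x : coset_rep (coset_rep x) = coset_rep x.
Proof. by rewrite -[in LHS](mulg1 (coset_rep x)) coset_rep_mul mulg1. Qed.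

(* The cosets in [us] form a finite set on which a finite group [K] mapping to
   [G] acts: it permutes the cosets in the [K]-invariant part [V] and fixes the
   other ones. *)
Section PartialAction.
Variables (K : finGroupType) (f : K -> G) (us V : seq G).
Hypothesis fM : {morph f : x y / x * y}.
Hypothesis V_us : {subset V <= us}.
Hypothesis V_rep : forall v, v \in V -> coset_rep v = v.
Hypothesis V_act : forall v a, v \in V -> coset_rep (v * f a) \in V.

(** Under [V_us] and [V_act] the default value of [insubd] never arises. *)
Definition partial_act (a : K) (u : seq_sub us) : seq_sub us :=
  if ssval u \in V then insubd u (coset_rep (ssval u * f a)) else u.

Lemma partial_act_val a u : ssval u \in V ->
  ssval (partial_act a u) = coset_rep (ssval u * f a).
Proof.
by move=> Vu; rewrite /partial_act Vu; apply: insubdK; apply/V_us/V_act.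
Qed.

Lemma partial_act_out a u : ssval u \notin V -> partial_act a u = u.
Proof. by rewrite /partial_act => /negbTE->. Qed.

Lemma partial_actM a b u : partial_act (a * b) u = partial_act b (partial_act a u).
Proof.
have [Vu|nVu] := boolP (ssval u \in V); last by rewrite !partial_act_out.
apply: val_inj; rewrite /= !partial_act_val //; first by rewrite coset_rep_mul fM mulgA.
exact: V_act.
Qed.

Lemma partial_act1 u : partial_act 1 u = u.
Proof.
have [Vu|nVu] := boolP (ssval u \in V); last by rewrite partial_act_out.
have f1 : f 1 = 1 by apply: (mulgI (f 1)); rewrite -fM !mulg1.
by apply: val_inj; rewrite /= partial_act_val // f1 mulg1 V_rep.
Qed.

End PartialAction.
End RightCosets.

(** * Gluing the two partial coset actions along [A] *)

Section AmalgamAction.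
Variables (G1 G2 A : finGroupType) (G : groupType).
Variables (phi1 : {morphism [set: A] >-> G1}) (phi2 : {morphism [set: A] >-> G2}).
Hypotheses (inj1 : 'injm phi1) (inj2 : 'injm phi2).
Variables (i1 : G1 -> G) (i2 : G2 -> G).
Hypotheses (i1M : {morph i1 : x y / x * y}) (i2M : {morph i2 : x y / x * y}).
Hypothesis i12 : forall a, i1 (phi1 a) = i2 (phi2 a).
Variables (H : G -> Prop) (sgH : is_subgroup H) (S : seq G).

Let c := coset_rep H.
Let V1 := [seq c (x * i1 a) | x <- S, a <- enum G1].
Let V2 := [seq c (x * i2 a) | x <- S, a <- enum G2].
Let us := V1 ++ V2.
Let U : finType := seq_sub us.

(* [G1] and [G2] act on finite sets of cosets containing those of [S], and the
   restrictions of these actions to [A] need not agree.  After taking the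
   product with [G1 * G2], on which [A] acts freely, they become conjugate. *)
Lemma amalgam_action : exists (T : finType) (alpha1 : G1 -> {perm T})
    (alpha2 : G2 -> {perm T}) (P : G -> {set T}),
  [/\ {morph alpha1 : x y / x * y}, {morph alpha2 : x y / x * y}
    & forall a, alpha1 (phi1 a) = alpha2 (phi2 a)] /\
  [/\ forall x a, x \in S -> x * i1 a \in S -> alpha1 a @: P x = P (x * i1 a),
      forall x a, x \in S -> x * i2 a \in S -> alpha2 a @: P x = P (x * i2 a),
      forall x y, H (x * y^-1) -> P x = P y
    & forall x y, x \in S -> P x = P y -> H (x * y^-1)].
Proof.
have cM x y : c (c x * y) = c (x * y) by apply: coset_rep_mul.
have cK x : c (c x) = c x by apply: coset_repK.
have V1_us : {subset V1 <= us} by move=> v Vv; rewrite mem_cat Vv.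
have V2_us : {subset V2 <= us} by move=> v Vv; rewrite mem_cat Vv orbT.
have V1_mem x a : x \in S -> c (x * i1 a) \in V1.
  by move=> Sx; apply: (allpairs_f (fun x a => c (x * i1 a))); rewrite ?mem_enum.
have V2_mem x a : x \in S -> c (x * i2 a) \in V2.
  by move=> Sx; apply: (allpairs_f (fun x a => c (x * i2 a))); rewrite ?mem_enum.
have V1_rep v : v \in V1 -> c v = v by case/allpairsP=> [[x a] [_ _ ->]].
have V2_rep v : v \in V2 -> c v = v by case/allpairsP=> [[x a] [_ _ ->]].
have V1_act v a : v \in V1 -> c (v * i1 a) \in V1.
  by case/allpairsP=> [[x b] /= [Sx _ ->]]; rewrite cM -mulgA -i1M V1_mem.
have V2_act v a : v \in V2 -> c (v * i2 a) \in V2.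
  by case/allpairsP=> [[x b] /= [Sx _ ->]]; rewrite cM -mulgA -i2M V2_mem.
have i11 : i1 1 = 1 by apply: (mulgI (i1 1)); rewrite -i1M !mulg1.
have i21 : i2 1 = 1 by apply: (mulgI (i2 1)); rewrite -i2M !mulg1.
have V1_S x : x \in S -> c x \in V1 by move=> Sx; rewrite -[x]mulg1 -i11 V1_mem.
have V2_S x : x \in S -> c x \in V2 by move=> Sx; rewrite -[x]mulg1 -i21 V2_mem.
pose m1 : G1 -> U -> U := partial_act H i1 V1; pose m2 : G2 -> U -> U := partial_act H i2 V2.
have m1M a b u : m1 (a * b) u = m1 b (m1 a u) by apply: partial_actM.
have m2M a b u : m2 (a * b) u = m2 b (m2 a u) by apply: partial_actM.
have m11 u : m1 1 u = u by apply: partial_act1.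
have m21 u : m2 1 u = u by apply: partial_act1.
have m1_val a u : ssval u \in V1 -> ssval (m1 a u) = c (ssval u * i1 a).
  exact: partial_act_val.
have m2_val a u : ssval u \in V2 -> ssval (m2 a u) = c (ssval u * i2 a).
  exact: partial_act_val.
have [r1 [p1 [rp1 r1A p1A r1r p1r]]] := coset_section inj1.
have [r2 [p2 [rp2 r2A p2A r2r p2r]]] := coset_section inj2.
have phi1M a b : phi1 (a * b) = phi1 a * phi1 b by rewrite morphM ?inE.
have phi2M a b : phi2 (a * b) = phi2 a * phi2 b by rewrite morphM ?inE.
have phi11 : phi1 1 = 1 by apply: morph1.
have phi21 : phi2 1 = 1 by apply: morph1.
pose T : finType := (U * G1 * G2)%type.
pose R1 a (t : T) : T := (m1 a t.1.1, t.1.2 * a, t.2).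
pose R2 a (t : T) : T := (m2 a t.1.1, t.1.2, t.2 * a).
have R1_inj a : injective (R1 a).
  by apply: (can_inj (g := R1 a^-1)) => [[[u x] y]]; rewrite /R1 /= -m1M mulgV m11 mulgK.
have R2_inj a : injective (R2 a).
  by apply: (can_inj (g := R2 a^-1)) => [[[u x] y]]; rewrite /R2 /= -m2M mulgV m21 mulgK.
pose Q1 a := perm (@R1_inj a); pose Q2 a := perm (@R2_inj a).
have Q1V a t : (Q1 a)^-1 t = R1 a^-1 t.
  apply: (@perm_inj _ (Q1 a)); rewrite permKV permE; case: t => [[u x] y].
  by rewrite /R1 /= -m1M mulVg m11 mulgVK.
have Q2V a t : (Q2 a)^-1 t = R2 a^-1 t.
  apply: (@perm_inj _ (Q2 a)); rewrite permKV permE; case: t => [[u x] y].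
  by rewrite /R2 /= -m2M mulVg m21 mulgVK.
(* The intertwiner of the two actions of [A]. It moves [u] by the inverse of [a] through [G1] and by
   [a] through [G2], and swaps the [A]-coordinates of the two group components, so that translating
   the first becomes translating the second. *)
pose th (t : T) : T :=
  let a := p1 t.1.2 in
  (m2 (phi2 a) (m1 (phi1 a^-1) t.1.1), r1 t.1.2 * phi1 (p2 t.2), r2 t.2 * phi2 a).
have th_inj : injective th.
  move=> [[u x] y] [[u' x'] y']; rewrite /th /= => -[Eu Ex Ey].
  (* The group components are recovered first; they determine the moves applied to [u], which can
     then be undone. *)
  have r1E : r1 x = r1 x' by rewrite -(r1r x (p2 y)) Ex r1r.
  have r2E : r2 y = r2 y' by rewrite -(r2r y (p1 x)) Ey r2r.
  have p1E : p1 x = p1 x' by rewrite -(p2r y (p1 x)) Ey p2r.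
  have p2E : p2 y = p2 y' by rewrite -(p1r x (p2 y)) Ex p1r.
  have xE : x = x' by rewrite (rp1 x) r1E p1E -rp1.
  have yE : y = y' by rewrite (rp2 y) r2E p2E -rp2.
  move: Eu; rewrite -p1E -xE -yE => /(congr1 (m2 (phi2 (p1 x)^-1))).
  rewrite -!m2M -phi2M mulgV phi21 !m21 => /(congr1 (m1 (phi1 (p1 x)))).
  by rewrite -!m1M -phi1M mulVg phi11 !m11 => ->.
have thR a t : th (R1 (phi1 a) t) = R2 (phi2 a) (th t).
  rewrite /th /R1 /R2 /= p1A r1A -m1M -phi1M -m2M -phi2M.
  by rewrite invMg mulKVg -mulgA phi2M.
pose Th := perm th_inj.
pose P x := [set t : T | ssval t.1.1 == c x].
have R1_P x a t : x \in S -> t \in P x -> R1 a t \in P (x * i1 a).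
  by rewrite !inE /= => Sx /eqP tx; rewrite m1_val tx ?V1_S // cM.
have R2_P x a t : x \in S -> t \in P x -> R2 a t \in P (x * i2 a).
  by rewrite !inE /= => Sx /eqP tx; rewrite m2_val tx ?V2_S // cM.
(* Over a coset from [S] both moves are genuine translations, and they cancel because the two copies
   of [A] agree in [G]. *)
have th_P x t : x \in S -> t \in P x -> th t \in P x.
  rewrite !inE /= => Sx /eqP tx.
  have uE : ssval (m1 (phi1 (p1 t.1.2)^-1) t.1.1) = c (x * i2 (phi2 (p1 t.1.2)^-1)).
    by rewrite m1_val tx ?V1_S // cM i12.
  by rewrite m2_val uE ?V2_mem // cM -mulgA -i2M -phi2M mulVg phi21 i21 mulg1.
(* An injection of the finite fibre into itself is onto, so the inverse preserves the fibre as
   well. *)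
have thV_P x t : x \in S -> t \in P x -> Th^-1 t \in P x.
  move=> Sx Pt; suff /setP/(_ t) : Th @: P x = P x.
    by rewrite Pt => /imsetP[t' Pt' ->]; rewrite permK.
  apply/eqP; rewrite eqEcard (card_imset _ perm_inj) leqnn andbT.
  by apply/subsetP=> _ /imsetP[t' Pt' ->]; rewrite permE th_P.
have imP (f : {perm T}) (B C : {set T}) : {in B, forall t, f t \in C} ->
    {in C, forall t, f^-1 t \in B} -> f @: B = C.
  move=> fBC fCB; apply/setP=> t; apply/imsetP/idP => [[t' Bt' ->]|Ct]; first exact: fBC.
  by exists (f^-1 t); rewrite ?permKV // fCB.
(* Products of permutations act from left to right, so conjugating [Q2] this way makes it agree with
   [Q1] on [A] by [thR]. *)
exists T, Q1, (fun a => Th * Q2 a * Th^-1), P; split; split.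
- by move=> a b; apply/permP => t; rewrite permM !permE /R1 /= m1M mulgA.
- move=> a b; rewrite -!mulgA mulKg !mulgA; congr (_ * _); rewrite -!mulgA; congr (_ * _).
  by apply/permP => t; rewrite permM !permE /R2 /= m2M mulgA.
- move=> a; apply/(canRL (mulgK _)); apply/permP => t.
  by rewrite !permM !permE thR.
- move=> x a Sx Sxa; apply: imP => t Pt; first by rewrite permE R1_P.
  by rewrite Q1V; have := R1_P _ a^-1 t Sxa Pt; rewrite -mulgA -i1M mulgV i11 mulg1.
- move=> x a Sx Sxa; apply: imP => t Pt.
    by rewrite !permM thV_P // !permE R2_P // th_P.
  rewrite !invMg invgK !permM thV_P //.
  rewrite Q2V; have Pt' : Th t \in P (x * i2 a) by rewrite permE th_P.
  by have := R2_P _ a^-1 _ Sxa Pt'; rewrite -mulgA -i2M mulgV i21 mulg1.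
- by move=> x y Hxy; rewrite /P /c (coset_rep_eq sgH Hxy).
move=> x y Sx Pxy; apply: (coset_rep_inj sgH).
(* The fibre over the coset of [x] is nonempty, so it determines that coset. *)
have us_x : c x \in us by rewrite V1_us ?V1_S.
have : ((SeqSub us_x, 1, 1) : T) \in P x by rewrite inE.
by rewrite Pxy inE => /eqP.
Qed.
End AmalgamAction.

(** * Separation in amalgams and the resulting algorithm *)

Section AmalgamSeparability.
Variables (X1 X2 : finType) (R1 : seq (word X1)) (R2 : seq (word X2)).
Variables (G1 G2 : finGroupType) (e1 : X1 -> G1) (e2 : X2 -> G2).
Hypotheses (presG1 : presents R1 e1) (presG2 : presents R2 e2).
Variables (A : finGroupType) (Y : {set A}).
Hypothesis genY : <<Y>> = [set: A].
Variables (phi1 : {morphism [set: A] >-> G1}) (phi2 : {morphism [set: A] >-> G2}).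
Hypotheses (inj1 : 'injm phi1) (inj2 : 'injm phi2).
Variables (u1 : A -> word X1) (u2 : A -> word X2).
Hypotheses (hu1 : forall a, a \in Y -> weval e1 (u1 a) = phi1 a).
Hypotheses (hu2 : forall a, a \in Y -> weval e2 (u2 a) = phi2 a).
Variables (G : groupType) (e : (X1 + X2)%type -> G).
Let Rel := amalgam_relators R1 R2 (enum Y) u1 u2.
Hypothesis presG : presents Rel e.

Let mem_Rel r : reflect
  [\/ exists2 s, s \in R1 & r = map_word inl s,
      exists2 s, s \in R2 & r = map_word inr s
    | exists2 a, a \in Y & r = map_word inl (u1 a) ++ inv_word (map_word inr (u2 a))]
  (r \in Rel).
Proof.
rewrite /Rel /amalgam_relators !mem_cat; apply: (iffP or3P).
  by case=> /mapP[s Hs ->];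
    [constructor 1 | constructor 2 | constructor 3]; exists s; rewrite // -mem_enum.
by case=> [][s Hs ->];
    [constructor 1 | constructor 2 | constructor 3]; apply: map_f; rewrite ?mem_enum.
Qed.

(** Passing to the induced action on subsets of [T] makes the fibre over [H] a single point. Reading
    [g] or a generator from there follows the cosets of its prefixes. *)
Lemma amalgam_separation (hs : seq (word (X1 + X2))) (g : word (X1 + X2)) :
    ~ generated [seq weval e h | h <- hs] (weval e g) ->
  exists (T : finType) (rho : (X1 + X2)%type -> {perm T}) (x0 : T),
    [/\ forall r, r \in Rel -> weval rho r = 1,
        forall h, h \in hs -> weval rho h x0 = x0 & weval rho g x0 <> x0].
Proof.
set H := generated _ => notHg.
have sgH : is_subgroup H by apply: generated_subgroup.
have eRel r : r \in Rel -> weval e r = 1 by apply: presents_relator.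
have [r R1r|i1 i1M i1E] := @presents_morph _ _ _ _ _ (e \o inl) presG1.
  by rewrite -weval_map eRel //; apply/mem_Rel; constructor 1; exists r.
have [r R2r|i2 i2M i2E] := @presents_morph _ _ _ _ _ (e \o inr) presG2.
  by rewrite -weval_map eRel //; apply/mem_Rel; constructor 2; exists r.
(* The relators give agreement on [Y] only, but the elements on which the two maps agree form a
   subgroup. *)
have i12 a : i1 (phi1 a) = i2 (phi2 a).
  pose B := [set a | i1 (phi1 a) == i2 (phi2 a)].
  have gB : group_set B.
    apply/group_setP; split=> [|x y]; rewrite !inE.
      by rewrite !morph1 -(weval_nil e1) -(weval_nil e2) i1E i2E !weval_nil.
    by move=> /eqP Ex /eqP Ey; rewrite !morphM ?inE // i1M i2M Ex Ey.
  suff: a \in Group gB by rewrite inE => /eqP.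
  have /subsetP-> //: [set: A] \subset Group gB.
  rewrite -genY gen_subG; apply/subsetP => b Yb; rewrite inE -hu1 // -hu2 //.
  rewrite i1E i2E -divg_eq1 -(weval_map e inl) -(weval_map e inr) -weval_inv -weval_cat eRel //.
  by apply/mem_Rel; constructor 3; exists b.
(* The values of all prefixes, from the empty one to the whole word. *)
pose S := [seq weval e (take k w) | w <- g :: hs, k <- iota 0 (size w).+1].
have S_take w k : w \in g :: hs -> k <= size w -> weval e (take k w) \in S.
  move=> gw le_k; apply: (allpairs_f_dep (fun w k => weval e (take k w))) => //.
  by rewrite mem_iota.
have S_w w : w \in g :: hs -> weval e w \in S.
  by move=> gw; rewrite -[w]take_size S_take.
have S_1 : 1 \in S by have := S_take g 0 (mem_head _ _) isT; rewrite take0 weval_nil.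
have [T [al1 [al2 [P [[al1M al2M al12] [P1 P2 P_eq P_inj]]]]]] :=
  amalgam_action inj1 inj2 i1M i2M i12 sgH S.
pose rho0 x := match x with inl x => al1 (e1 x) | inr x => al2 (e2 x) end.
pose ac : {perm T} -> {perm {set T}} := actperm 'P^*.
have acM : {morph ac : s t / s * t} by move=> s t; rewrite /ac morphM ?inE.
have acE s B : ac s B = s @: B by rewrite /ac actpermE.
pose rho := ac \o rho0.
have rhoE w : weval rho w = ac (weval rho0 w) by rewrite (weval_morph _ _ acM).
have rho0_1 w : weval rho0 (map_word inl w) = al1 (weval e1 w).
  by rewrite weval_map (weval_morph _ _ al1M).
have rho0_2 w : weval rho0 (map_word inr w) = al2 (weval e2 w).
  by rewrite weval_map (weval_morph _ _ al2M).
have ac1 : ac 1 = 1 by rewrite -(weval_nil rho0) -rhoE weval_nil.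
(* A letter comes from one factor and moves the fibres correctly as long as both ends of the step
   lie in [S]. *)
have step x l : x \in S -> x * weval e [:: l] \in S ->
    weval rho [:: l] (P x) = P (x * weval e [:: l]).
  case: l => [[y|y] b] Sx; rewrite rhoE acE.
    have -> : weval e [:: (inl y, b)] = i1 (weval e1 [:: (y, b)]).
      by rewrite i1E -(weval_map e inl).
    by rewrite -[[:: (inl y, b)]]/(map_word inl [:: (y, b)]) rho0_1; apply: P1.
  have -> : weval e [:: (inr y, b)] = i2 (weval e2 [:: (y, b)]).
    by rewrite i2E -(weval_map e inr).
  by rewrite -[[:: (inr y, b)]]/(map_word inr [:: (y, b)]) rho0_2; apply: P2.
have path w k : w \in g :: hs -> k <= size w ->
    weval rho (take k w) (P 1) = P (weval e (take k w)).
  move=> gw; elim: k => [|k IHk] lt_k; first by rewrite take0 !weval_nil perm1.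
  case: w => [|l0 w] // in gw lt_k IHk *.
  have := S_take _ _ gw lt_k.
  rewrite (take_nth l0) // -cats1 !weval_cat permM IHk ?(ltnW lt_k) //.
  by move=> Sl; rewrite step // S_take // ltnW.
have pathw w : w \in g :: hs -> weval rho w (P 1) = P (weval e w).
  by move=> gw; have := path w (size w) gw (leqnn _); rewrite take_size.
exists {set T}, rho, (P 1); split.
- move=> r; rewrite rhoE -[RHS]ac1 => /mem_Rel Rr; congr (ac _).
  have al11 : al1 1 = 1 by rewrite -(weval_nil e1) -rho0_1 weval_nil.
  have al21 : al2 1 = 1 by rewrite -(weval_nil e2) -rho0_2 weval_nil.
  case: Rr => [] [s Hs ->].
  + by rewrite rho0_1 (presents_relator presG1).
  + by rewrite rho0_2 (presents_relator presG2).
  by rewrite weval_cat weval_inv rho0_1 rho0_2 hu1 // hu2 // al12 mulgV.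
- move=> h hs_h; rewrite pathw ?inE ?hs_h ?orbT //; apply: P_eq.
  by rewrite invg1 mulg1; apply: generated_mem; apply: map_f.
rewrite pathw ?mem_head // => /P_inj; rewrite invg1 mulg1 => Hg.
by apply: notHg; apply: Hg; apply: S_w; rewrite mem_head.
Qed.

(** A certificate exists by completeness, so the search ends; whichever certificate it finds is
    sound. The check is negated because the search looks for a zero. *)
Lemma amalgam_separability_solvable : separability_solvable e.
Proof.
pose N := #|{: X1 + X2}|.*2.
have [||p pP] := @computable_search
  (fun c x => ~~ certifies N (words_code Rel) c x) (gensc N).
- by apply: computable_negb; apply: computable_certifies.
- exact: computable_gensc.
exists p => hs g H notHg.
have [T [rho [x0 [rhoR rho_hs rho_g]]]] := amalgam_separation notHg.
have [c c_ok] := perm_certifies rhoR rho_hs rho_g.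
have [|c' /eqP] := pP (words_code (g :: hs)) c; first by rewrite c_ok.
rewrite eqb0 negbK => c'_ok; have [ks -> Hks] := certifies_separating presG c'_ok.
by exists ks.
Qed.

End AmalgamSeparability.

Theorem theorem8p1
  (X1 X2 : finType) (R1 : seq (word X1)) (R2 : seq (word X2))
  (G1 G2 : finGroupType) (e1 : X1 -> G1) (e2 : X2 -> G2)
  (presG1 : presents R1 e1) (presG2 : presents R2 e2)
  (A : finGroupType) (Y : {set A}) (genY : <<Y>> = [set: A])
  (phi1 : {morphism [set: A] >-> G1}) (phi2 : {morphism [set: A] >-> G2})
  (inj1 : 'injm phi1) (inj2 : 'injm phi2)
  (u1 : A -> word X1) (u2 : A -> word X2)
  (hu1 : forall a, a \in Y -> weval e1 (u1 a) = phi1 a)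
  (hu2 : forall a, a \in Y -> weval e2 (u2 a) = phi2 a)
  (G : groupType) (e : (X1 + X2)%type -> G)
  (presG : presents (amalgam_relators R1 R2 (enum Y) u1 u2) e) :
  (cyclic [set: A]
   \/ (malnormal (phi1 @* [set: A]) [set: G1]
       \/ malnormal (phi2 @* [set: A]) [set: G2])
   \/ (phi1 @* [set: A] \subset 'Z([set: G1])
       \/ phi2 @* [set: A] \subset 'Z([set: G2]))
   -> separability_solvable e)
  /\ (abelian [set: G1] \/ abelian [set: G2] -> separability_solvable e).
Proof.
have solvable_e : separability_solvable e.
  exact: (amalgam_separability_solvable presG1 presG2 genY inj1 inj2 hu1 hu2 presG).
by split.
Qed.
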